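(* Let $K\ge1$ be an integer, $t>0$, $\lambda\in(0,1]$. Let $P_{XV}$ be a joint probability distribution of a pair of views $(X,V)$ taking values in $\mathcal{X}\times\mathcal{X}$, with marginals $P_X$ and $P_V$; let $\phi:\mathcal{X}\to\mathbb{R}^d$ be an encoder and $f:\mathbb{R}^d\to\mathbb{R}^m$ a projection head that is Lipschitz with Lipschitz constant $\mathrm{Lip}(f)$ with respect to Euclidean norms. If $\lambda K>1-\lambda$ and $f$ projects the representation to the unit hypersphere (i.e. $\|f(z)\|=1$ for all $z$), then $$-\mathbb{E}\left[\mathcal{L}^{\lambda,q=1}_{\mathrm{RINCE}}(\mathbf{s})\right]\le\frac{\mathrm{Lip}(f)\cdot(1-\lambda)\cdot e^{1/t}}{t}\;\mathcal{W}_1\!\left(P^\phi_{XV},\,P^\phi_X P^\phi_V\right),$$ where the expectation is over $(x,v)\sim P_{XV}$ and $v_1,\dots,v_K\sim P_V$ drawn independently of each other and of $(x,v)$, and $\mathbf{s}=(s^+,s_1^-,\dots,s_K^-)$ with $s^+=f(\phi(x))^Tf(\phi(v))/t$ and $s_i^-=f(\phi(x))^Tf(\phi(v_i))/t$.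
   Context: For $\mathbf{s}=(s^+,s_1^-,\dots,s_K^-)\in\mathbb{R}^{K+1}$, $q,\lambda\in(0,1]$, $$\mathcal{L}^{\lambda,q}_{\mathrm{RINCE}}(\mathbf{s})=\frac{-e^{q s^+}}{q}+\frac{\left(\lambda\left(e^{s^+}+\sum_{i=1}^K e^{s_i^-}\right)\right)^q}{q};$$ in particular for $q=1$ it equals $-(1-\lambda)e^{s^+}+\lambda\sum_{i=1}^K e^{s_i^-}$. $P^\phi_{XV}$ denotes the law of $(\phi(X),\phi(V))$ on $\mathbb{R}^d\times\mathbb{R}^d$ for $(X,V)\sim P_{XV}$; $P^\phi_X P^\phi_V$ denotes the product of the pushforwards $\phi_\#P_X$ and $\phi_\#P_V$. The maps are measurable. For probability measures $\mu,\nu$ on $\mathbb{R}^d\times\mathbb{R}^d$, the Wasserstein-1 distance is $$\mathcal{W}_1(\mu,\nu)=\inf_{\pi\in\Pi(\mu,\nu)}\mathbb{E}_{((X,V),(X',V'))\sim\pi}\left[\|X-X'\|+\|V-V'\|\right],$$ where $\Pi(\mu,\nu)$ is the set of couplings of $\mu$ and $\nu$ and $\|\cdot\|$ is the Euclidean norm. (The value $+\infty$ is allowed.) *)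

(* Defs.v *)
From HB Require Import structures.
From mathcomp Require Import all_boot all_order all_algebra.
From mathcomp Require Import all_classical all_reals all_analysis.

Set Implicit Arguments.
Unset Strict Implicit.
Unset Printing Implicit Defensive.

Import Order.TTheory GRing.Theory Num.Theory.
Import numFieldNormedType.Exports.

Local Open Scope classical_set_scope.
Local Open Scope ring_scope.

(* Row vectors carry the Borel sigma-algebra, generated by the open sets of   *)
(* their library topology, which is the usual one.                            *)
Section borel_rV.
Context {R : realType} {n : nat}.

Definition rV_opens : set_system 'rV[R]_n := [set U | open U].

HB.instance Definition _ := @isMeasurable.Build (sigma_display rV_opens)
  'rV[R]_n <<s rV_opens >> (@sigma_algebra0 _ setT rV_opens)
  (@sigma_algebraC _ rV_opens) (@sigma_algebra_bigcup _ setT rV_opens).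

End borel_rV.

(* The library norm on row vectors is the sup norm, so the Euclidean one is   *)
(* defined here.                                                              *)
Section euclidean.
Context {R : realType}.

Definition dotv {n : nat} (u v : 'rV[R]_n) : R := \sum_(i < n) u 0 i * v 0 i.

Definition score {n : nat} (t : R) (u v : 'rV[R]_n) : R := dotv u v / t.

Definition enorm {n : nat} (u : 'rV[R]_n) : R := Num.sqrt (dotv u u).

Definition lipschitz_bound {d m : nat} (f : 'rV[R]_d -> 'rV[R]_m) (L : R) :=
  0 <= L /\ forall x y, enorm (f x - f y) <= L * enorm (x - y).

Definition enorm_lipschitz {d m : nat} (f : 'rV[R]_d -> 'rV[R]_m) :=
  exists L, lipschitz_bound f L.

(* The least Lipschitz bound; meaningful when [enorm_lipschitz f]. *)
Definition Lip {d m : nat} (f : 'rV[R]_d -> 'rV[R]_m) : R :=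
  inf [set L | lipschitz_bound f L].

End euclidean.

Definition RINCE {R : realType} {K : nat} (lambda q : R)
    (sp : R) (sm : 'I_K -> R) : R :=
  - expR (q * sp) / q
  + (lambda * (expR sp + \sum_(i < K) expR (sm i))) `^ q / q.

Section fst_snd.
Context d1 d2 (T1 : measurableType d1) (T2 : measurableType d2).

HB.instance Definition _ :=
  isMeasurableFun.Build _ _ (T1 * T2)%type T1 fst measurable_fst.
HB.instance Definition _ :=
  isMeasurableFun.Build _ _ (T1 * T2)%type T2 snd measurable_snd.

End fst_snd.

Section map_both.
Context d1 d2 (T1 : measurableType d1) (T2 : measurableType d2).
Variable phi : {mfun T1 >-> T2}.

Definition map_both (p : T1 * T1) : T2 * T2 := (phi p.1, phi p.2).

Let measurable_map_both : measurable_fun [set: T1 * T1] map_both.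
Proof.
apply: measurable_fun_pair.
- exact: measurableT_comp (measurable_funPT phi) measurable_fst.
- exact: measurableT_comp (measurable_funPT phi) measurable_snd.
Qed.

HB.instance Definition _ :=
  isMeasurableFun.Build _ _ _ _ map_both measurable_map_both.

End map_both.

(* Values of a measure outside the sigma-algebra are junk, so laws are        *)
(* compared on measurable sets only.                                          *)
Definition same_law {R : realType} d (T : measurableType d)
    (P Q : probability T R) := forall A, measurable A -> P A = Q A.

Definition couplings {R : realType} d (T : measurableType d)
    (mu nu : probability T R) : set (probability (T * T)%type R) :=
  [set pi | same_law (distribution pi fst) mu
          /\ same_law (distribution pi snd) nu].

Definition wasserstein1 {R : realType} {n : nat}
    (mu nu : probability ('rV[R]_n * 'rV[R]_n)%type R) : \bar R :=
  ereal_inf [set (\int[pi]_p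
      (enorm (p.1.1 - p.2.1) + enorm (p.1.2 - p.2.2))%:E)%E
    | pi in couplings mu nu].

Section independence.
Context {R : realType} d (Omega : measurableType d) (Pr : probability Omega R).

Definition sigma_of d' (T : measurableType d') (X : {RV Pr >-> T}) :
    set_system Omega := preimage_set_system setT X measurable.

Definition mutually_independent (I : finType) (F : I -> set_system Omega) :=
  forall (J : {set I}) (E : I -> set Omega),
    (forall i, i \in J -> F i (E i)) ->
    Pr (\bigcap_(i in [set` J]) E i) = (\prod_(i in J) Pr (E i))%E.

End independence.

(* Z is drawn from P, the W i from the second marginal of P, all of them      *)
(* jointly independent; None indexes Z.                                       *)
Definition contrastive_sample {R : realType} d d' (Omega : measurableType d)
    (T : measurableType d') (Pr : probability Omega R)
    (P : probability (T * T)%type R) (K : nat)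
    (Z : {RV Pr >-> (T * T)%type}) (W : 'I_K -> {RV Pr >-> T}) :=
  [/\ same_law (distribution Pr Z) P,
      (forall i, same_law (distribution Pr (W i)) (distribution P snd)) &
      mutually_independent Pr (fun o : option 'I_K =>
        if o is Some i then sigma_of (W i) else sigma_of Z)].

(* Main.v *)
(* The positive kernel g(a, b) = exp (<f a, f b> / t) takes values in
   ]0, e^(1/t)]; as f is unit-valued, g is Lipschitz for the cost |a - a'| +
   |b - b'| with constant Lip f * e^(1/t) / t.  For q = 1 the loss is linear in
   the exponentials, and independence makes (phi x, phi v_i) distributed as the
   product of the marginals, so
     - E L = (1 - lambda) E_joint g - lambda K E_prod g
          <= (1 - lambda) (E_joint g - E_prod g),
   by lambda K > 1 - lambda and g >= 0.  Integrating the Lipschitz bound against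
   any coupling (the easy half of Kantorovich duality) bounds the last
   difference by W1. *)
Require Import Defs.
From HB Require Import structures.
From mathcomp Require Import all_boot all_order all_algebra.
From mathcomp Require Import all_classical all_reals all_analysis.
From mathcomp Require Import measurable_realfun ring lra.

Set Implicit Arguments.

Import Order.TTheory GRing.Theory Num.Theory.
Import numFieldNormedType.Exports.

Local Open Scope classical_set_scope.
Local Open Scope ring_scope.

(** * Euclidean inner product and norm on row vectors *)

Section euclidean_norm.
Context {R : realType} {n : nat}.
Implicit Types u v w : 'rV[R]_n.

Lemma dotvv_ge0 u : 0 <= dotv u u.
Proof. by apply: sumr_ge0 => i _; rewrite -expr2 sqr_ge0. Qed.

Lemma dotvBl u v w : dotv (u - v) w = dotv u w - dotv v w.
Proof. by rewrite /dotv -sumrB; apply: eq_bigr => i _; rewrite !mxE mulrBl. Qed.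

Lemma dotvC u v : dotv u v = dotv v u.
Proof. by apply: eq_bigr => i _; rewrite mulrC. Qed.

Lemma dotvZl a u v : dotv (a *: u) v = a * dotv u v.
Proof.
by rewrite /dotv mulr_sumr; apply: eq_bigr => i _; rewrite !mxE mulrA.
Qed.

Lemma enorm_ge0 u : 0 <= enorm u.
Proof. exact: sqrtr_ge0. Qed.

Lemma dotv_enorm u : dotv u u = enorm u ^+ 2.
Proof. by rewrite sqr_sqrtr// dotvv_ge0. Qed.

(** Cauchy-Schwarz against a unit vector: expand the nonnegative square of [u - dotv u v *: v], the
    component of [u] orthogonal to [v]. *)
Lemma normr_dotv_unit u v : enorm v = 1 -> `|dotv u v| <= enorm u.
Proof.
move=> v1; rewrite -[leLHS]sqrtr_sqr ler_sqrt ?dotvv_ge0//.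
have := dotvv_ge0 (u - dotv u v *: v).
rewrite dotvBl ![dotv _ (_ - _)]dotvC !dotvBl !dotvZl ![dotv _ (_ *: _)]dotvC.
rewrite !dotvZl (dotvC v u) (dotv_enorm v) v1.
lra.
Qed.

Lemma normr_coord_enorm u i : `|u 0 i| <= enorm u.
Proof.
rewrite -sqrtr_sqr ler_sqrt ?dotvv_ge0// /dotv (bigD1 i)//= -expr2 lerDl.
by apply: sumr_ge0 => j _; rewrite -expr2 sqr_ge0.
Qed.

(** The topology comes from the sup norm, so continuity is reduced to that of the coordinates. *)
Lemma continuous_enorm_subl u : continuous (fun v => enorm (u - v)).
Proof.
move=> v; apply: (continuous_comp (f := fun v => dotv (u - v) (u - v)));
  last exact: sqrt_continuous.
rewrite /continuous_at /dotv.
apply: cvg_big => [||i _]; [exact: add_continuous|exact: nbhs_filter|].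
suff coordB : continuous (fun w : 'rV[R]_n => (u - w) 0 i).
  exact: (continuousM (coordB v) (coordB v)).
rewrite (_ : (fun _ => _) = cst (u 0 i) \- (fun w : 'rV[R]_n => w 0 i)).
  by move=> w; apply: continuousB;
    [exact: cst_continuous|exact: coord_continuous].
by apply/funext => w; rewrite !mxE.
Qed.

End euclidean_norm.

(** * Borel measurability on row vectors *)

Section borel.
Context {R : realType} {n : nat}.

Lemma continuous_rV_measurable (h : 'rV[R]_n -> R) :
  continuous h -> measurable_fun setT h.
Proof.
move=> /continuousP hc.
apply: (measurability _ (RGenOInfty.measurableE R)).
move=> _ [_ [x ->] <-]; rewrite setTI.
apply: sub_sigma_algebra; rewrite /rV_opens/=; apply: hc.
exact: rray_open.
Qed.

Lemma measurable_coord (i : 'I_n) :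
  measurable_fun setT (fun u : 'rV[R]_n => u 0 i).
Proof. by apply: continuous_rV_measurable; exact: coord_continuous. Qed.

Lemma measurable_dotv d (T : measurableType d) (f g : T -> 'rV[R]_n) :
  (forall i, measurable_fun setT (fun x => f x 0 i)) ->
  (forall i, measurable_fun setT (fun x => g x 0 i)) ->
  measurable_fun setT (fun x => dotv (f x) (g x)).
Proof. by move=> mf mg; apply: measurable_sum => i; exact: measurable_funM. Qed.

Lemma measurable_enorm_sub d (T : measurableType d) (f g : T -> 'rV[R]_n) :
  measurable_fun setT f -> measurable_fun setT g ->
  measurable_fun setT (fun x => enorm (f x - g x)).
Proof.
move=> mf mg.
have msqrt : measurable_fun setT (@Num.sqrt R).
  by apply: continuous_measurable_fun; exact: sqrt_continuous.
apply: (measurableT_comp msqrt).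
by apply: measurable_dotv => i; under eq_fun do rewrite !mxE;
  apply: measurable_funB; exact: (measurableT_comp (measurable_coord i)).
Qed.

End borel.

(** * The least Lipschitz constant and measurability of Lipschitz maps *)

Section lipschitz.
Context {R : realType} {d m : nat} (f : 'rV[R]_d -> 'rV[R]_m).
Hypothesis lipf : enorm_lipschitz f.

(** The infimum is attained: for fixed [x] and [y], dividing by their distance turns the condition
    on [L] into a lower bound on [L], which passes to the infimum. *)
Lemma lipschitz_bound_Lip : lipschitz_bound f (Lip f).
Proof.
have [L0 fL0] := lipf.
have lb0 : lbound [set L | lipschitz_bound f L] 0 by move=> L [].
split; first by apply: lb_le_inf => //; exists L0.
(* At distance zero no division is possible, but any bound [L0] already forces the left side to be
   at most 0. *)
move=> x y; have [xy0|xy0] := eqVneq (enorm (x - y)) 0.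
  by have [_ /(_ x y)] := fL0; rewrite xy0 !mulr0.
have xy_gt0 : 0 < enorm (x - y) by rewrite lt0r xy0 enorm_ge0.
rewrite -ler_pdivrMr//; apply: lb_le_inf; first by exists L0.
by move=> L [_ /(_ x y)]; rewrite ler_pdivrMr.
Qed.

Lemma measurable_lipschitz_coord i : measurable_fun setT (fun x => f x 0 i).
Proof.
apply: continuous_rV_measurable => x.
apply/(@cvgrPdist_le _ _ _ _ (nbhs_filter x)) => e e0.
have [L0 fL] := lipschitz_bound_Lip.
have : Lip f * enorm (x - y) @[y --> x] --> Lip f * enorm (x - x).
  apply: (continuousM (@cst_continuous _ _ (Lip f) x)).
  exact: continuous_enorm_subl.
have -> : Lip f * enorm (x - x) = 0.
  by rewrite subrr /enorm /dotv big1 ?sqrtr0 ?mulr0// => j _; rewrite mxE mul0r.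
move=> /(@cvgr0Pnorm_le _ _ _ _ (nbhs_filter x))/(_ _ e0).
apply: (@filterS _ _ (nbhs_filter x)) => y; apply: le_trans.
have := normr_coord_enorm (f x - f y) i; rewrite !mxE => /le_trans; apply.
exact/(le_trans (fL x y))/ler_norm.
Qed.

End lipschitz.

(** * Boundedness and Lipschitz continuity of the exponential kernel *)

Section positive_kernel.
Context {R : realType} {d m : nat} (f : 'rV[R]_d -> 'rV[R]_m) (t : R).
Hypotheses (t_gt0 : 0 < t) (lipf : enorm_lipschitz f).
Hypothesis f_unit : forall z, enorm (f z) = 1.

Let g (p : 'rV[R]_d * 'rV[R]_d) : R := expR (score t (f p.1) (f p.2)).

Lemma expR_score_le p : g p <= expR (1 / t).
Proof.
rewrite ler_expR ler_pM2r ?invr_gt0// -(f_unit p.1).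
exact/(le_trans (ler_norm _))/normr_dotv_unit.
Qed.

Lemma measurable_expR_score : measurable_fun setT g.
Proof.
apply: measurableT_comp => //; apply: measurable_funM => //.
by apply: measurable_dotv => i;
  exact: (measurableT_comp (measurable_lipschitz_coord lipf i)).
Qed.

Lemma expR_score_lipschitz p q :
  g p - g q <= Lip f * expR (1 / t) / t *
    (enorm (p.1 - q.1) + enorm (p.2 - q.2)).
Proof.
have [L0 fL] := lipschitz_bound_Lip lipf.
set x := score t (f p.1) (f p.2); set y := score t (f q.1) (f q.2).
have xy : x - y <= Lip f / t * (enorm (p.1 - q.1) + enorm (p.2 - q.2)).
  (* Telescope through the mixed product of [f q.1] and [f p.2], so that each term pairs a
     difference with a unit vector. *)
  have -> : x - y = (dotv (f p.1 - f q.1) (f p.2) +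
                     dotv (f p.2 - f q.2) (f q.1)) / t.
    rewrite !dotvBl (dotvC (f p.2) (f q.1)) (dotvC (f q.2) (f q.1)).
    by rewrite /x /y /score; ring.
  rewrite mulrAC ler_pM2r ?invr_gt0// mulrDr.
  by apply: lerD; apply: le_trans (fL _ _); apply: le_trans (ler_norm _) _;
    exact: normr_dotv_unit.
have gxy : g p - g q <= expR x * (x - y).
  (* e^x - e^y = e^x (1 - e^(y - x)) <= e^x (x - y) *)
  have -> : g q = expR x * expR (y - x) by rewrite -expRD addrC subrK.
  rewrite -[X in X - _]mulr1 -mulrBr ler_pM2l ?expR_gt0//.
  by have := expR_ge1Dx (y - x); lra.
(* Since [x - y] may be negative, [expR x] is enlarged to [expR (1 / t)] only once [x - y] has been
   replaced by this nonnegative bound. *)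
have b_ge0 : 0 <= Lip f / t * (enorm (p.1 - q.1) + enorm (p.2 - q.2)).
  by rewrite mulr_ge0 ?addr_ge0 ?enorm_ge0// divr_ge0// ltW.
have -> : Lip f * expR (1 / t) / t = expR (1 / t) * (Lip f / t) by ring.
rewrite -[leRHS]mulrA; apply: (le_trans gxy).
apply: (@le_trans _ _ (expR x * (Lip f / t *
    (enorm (p.1 - q.1) + enorm (p.2 - q.2))))).
  by rewrite ler_pM2l ?expR_gt0.
by rewrite ler_wpM2r//; exact: expR_score_le.
Qed.

End positive_kernel.

(** * Couplings and the easy half of Kantorovich duality *)

Section transport.
Context {R : realType}.
Local Open Scope ereal_scope.

(** The independent coupling guarantees that the infimum defining [wasserstein1] runs over a
    nonempty set. *)
Lemma couplings_product d (T : measurableType d) (mu nu : probability T R) :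
  couplings mu nu (mu \x nu : probability _ R).
Proof.
split=> A mA; rewrite /distribution/= /pushforward.
- have -> : fst @^-1` A = A `*` [set: T] by apply/seteqP; split=> x /= => [|[]].
  by rewrite -[RHS]mule1 -(probability_setT nu); exact: product_measure1E.
- have -> : snd @^-1` A = [set: T] `*` A by apply/seteqP; split=> x /= => [|[]].
  by rewrite -[RHS]mul1e -(probability_setT mu); exact: product_measure1E.
Qed.

(** Change of variables: the integral depends only on the values of the measure on measurable sets,
    which is all that [same_law] controls. *)
Lemma ge0_integral_law d (T : measurableType d) d' (T' : measurableType d')
    (P : probability T R) (Q : probability T' R) (X : {mfun T >-> T'})
    (g : T' -> \bar R) :
  same_law (distribution P X) Q -> measurable_fun setT g ->
  (forall y, 0 <= g y) -> \int[Q]_y g y = \int[P]_x g (X x).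
Proof.
move=> XQ mg g0; rewrite (eq_measure_integral (distribution P X)).
  by rewrite ge0_integral_distribution.
by move=> A mA _; exact: (esym (XQ _ mA)).
Qed.

Context {n : nat}.
Implicit Types mu nu : probability ('rV[R]_n * 'rV[R]_n)%type R.

Let cost (p : ('rV[R]_n * 'rV[R]_n) * ('rV[R]_n * 'rV[R]_n)) : R :=
  (enorm (p.1.1 - p.2.1) + enorm (p.1.2 - p.2.2))%R.

Lemma measurable_cost : measurable_fun setT cost.
Proof.
apply: measurable_funD; apply: measurable_enorm_sub.
- exact: (measurableT_comp measurable_fst measurable_fst).
- exact: (measurableT_comp measurable_fst measurable_snd).
- exact: (measurableT_comp measurable_snd measurable_fst).
- exact: (measurableT_comp measurable_snd measurable_snd).
Qed.

Lemma integral_le_wasserstein1 mu nu (g : 'rV[R]_n * 'rV[R]_n -> R) (C : R) :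
  measurable_fun setT g -> (forall p, 0 <= g p)%R -> (0 <= C)%R ->
  \int[nu]_p (g p)%:E \is a fin_num ->
  (forall p q, g p - g q <=
    C * (enorm (p.1 - q.1) + enorm (p.2 - q.2)))%R ->
  \int[mu]_p (g p)%:E - \int[nu]_p (g p)%:E <= C%:E * wasserstein1 mu nu.
Proof.
move=> mg g0 C0 nufin gC.
have mgE : measurable_fun setT (EFin \o g) by exact/measurable_EFinP.
have cost0 p : (0 <= cost p)%R by rewrite addr_ge0 ?enorm_ge0.
have coupled pi : couplings mu nu pi ->
    \int[mu]_p (g p)%:E - \int[nu]_p (g p)%:E <= C%:E * \int[pi]_p (cost p)%:E.
  (* The cost may fail to be integrable, hence the subtraction-free form. *)
  move=> [pi1 pi2]; rewrite leeBlDl//.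
  have gE0 p : 0 <= (g p)%:E by rewrite lee_fin.
  (* Both integrals move to the coupling, where the Lipschitz bound applies pointwise. *)
  rewrite (ge0_integral_law pi1)// (ge0_integral_law pi2)//.
  have mc : measurable_fun setT (EFin \o cost).
    by apply/measurable_EFinP; exact: measurable_cost.
  rewrite -ge0_integralZl//; last by move=> p _; rewrite lee_fin.
  rewrite -ge0_integralD//; first last.
  - exact: measurable_funeM.
  - by move=> p _; rewrite mule_ge0 ?lee_fin.
  - exact: (measurableT_comp mgE measurable_snd).
  apply: ge0_le_integral => //.
  - exact: (measurableT_comp mgE measurable_fst).
  - apply: emeasurable_funD; last exact: measurable_funeM.
    exact: (measurableT_comp mgE measurable_snd).
  - by move=> p _; rewrite -EFinM -EFinD lee_fin -lerBlDl gC.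
(* If C = 0 then C * W1 = 0 even for W1 = +oo, and the bound needs the existence
   of some coupling. *)
move: C0; rewrite le_eqVlt => /predU1P[C0|C_gt0].
  by have := coupled _ (couplings_product mu nu); rewrite -C0 !mul0e.
(* Division by [C > 0] makes the left side a lower bound of all coupling costs, hence of their
   infimum. *)
rewrite muleC -lee_pdivrMr//; apply: le_ereal_inf_tmp => _ [pi /coupled Hpi <-].
by rewrite lee_pdivrMr// muleC.
Qed.

End transport.

(** * From mutual to pairwise independence *)

Section independence.
Context {R : realType} d (Omega : measurableType d) (Pr : probability Omega R).

Lemma mutually_independent2 (I : finType) (F : I -> set_system Omega)
    (i j : I) A B :
  mutually_independent Pr F -> i != j -> F i A -> F j B ->
  (Pr (A `&` B) = Pr A * Pr B)%E.
Proof.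
move=> indF ij FA FB.
(* The family must be defined at every index, but only its values at [i] and [j] enter the product
   over the pair. *)
pose E k := if k == i then A else B.
have := indF [set i; j]%SET E; rewrite big_setU1 ?inE//= big_set1.
rewrite /E eqxx eq_sym (negbTE ij) => <-.
  congr (Pr _); apply/seteqP; split => [w [Aw Bw] k /=|w ABw].
    by rewrite !inE; case: eqP.
  split.
    by have := ABw i; rewrite /= !inE eqxx; exact.
  by have := ABw j; rewrite /= !inE eqxx orbT eq_sym (negbTE ij); exact.
by move=> k; rewrite !inE => /orP[]/eqP->;
  rewrite ?eqxx// eq_sym (negbTE ij).
Qed.

End independence.

(** * Joint laws of independent variables *)

Section joint_law.
Context d (Omega : measurableType d).
Context dS (S : measurableType dS) dT (T : measurableType dT).

Definition pair_mfun (Y : {mfun Omega >-> S}) (Z : {mfun Omega >-> T})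
  (w : Omega) : S * T := (Y w, Z w).

HB.instance Definition _ Y Z := isMeasurableFun.Build _ _ _ _ (pair_mfun Y Z)
  (measurable_fun_pair (measurable_funPT Y) (measurable_funPT Z)).

Context {R : realType} (Pr : probability Omega R).

(** Independence gives agreement on measurable rectangles, and a product measure is determined by
    its values there. *)
Lemma same_law_pair (mu : probability S R) (nu : probability T R)
    (Y : {RV Pr >-> S}) (Z : {RV Pr >-> T}) :
  same_law (distribution Pr Y) mu -> same_law (distribution Pr Z) nu ->
  (forall A B, measurable A -> measurable B ->
     Pr (Y @^-1` A `&` Z @^-1` B) = Pr (Y @^-1` A) * Pr (Z @^-1` B))%E ->
  same_law (distribution Pr (pair_mfun Y Z)) (mu \x nu : probability _ R)%E.
Proof.
move=> Ymu Znu indYZ C mC; apply/esym/product_measure_unique => // A B mA mB.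
transitivity (Pr (Y @^-1` A `&` Z @^-1` B)) => //.
rewrite indYZ//; exact: (congr2 mule (Ymu A mA) (Znu B mB)).
Qed.

Lemma same_law_comp (mu : probability S R) (Y : {RV Pr >-> S})
    (h : {mfun S >-> T}) :
  same_law (distribution Pr Y) mu ->
  same_law (distribution Pr (h \o Y)) (distribution mu h).
Proof. by move=> Ymu A mA; apply: Ymu; exact: measurable_funPTI. Qed.

End joint_law.

(** The sign of [lambda] makes the base of the power nonnegative, so that exponent 1 returns the
    base. *)
Lemma RINCE1E (R : realType) K (lambda sp : R) (sm : 'I_K -> R) :
  0 <= lambda ->
  RINCE lambda 1 sp sm =
  lambda * (\sum_(i < K) expR (sm i)) - (1 - lambda) * expR sp.
Proof.
move=> l0; rewrite /RINCE mul1r !divr1 powRr1; first by ring.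
by rewrite mulr_ge0// addr_ge0 ?expR_ge0// sumr_ge0// => i _; exact: expR_ge0.
Qed.

(** * Expected loss against the Wasserstein distance *)

Theorem theorem3 (R : realType) (K : nat) (t lambda : R)
  (dX : measure_display) (X : measurableType dX)
  (P : probability (X * X)%type R)
  (d m : nat) (phi : {mfun X >-> 'rV[R]_d}) (f : 'rV[R]_d -> 'rV[R]_m)
  (dO : measure_display) (Omega : measurableType dO)
  (Pr : probability Omega R)
  (xv : {RV Pr >-> (X * X)%type}) (vneg : 'I_K -> {RV Pr >-> X}) :
  (1 <= K)%N -> 0 < t -> 0 < lambda <= 1 ->
  enorm_lipschitz f -> (forall z, enorm (f z) = 1) ->
  lambda * K%:R > 1 - lambda ->
  contrastive_sample P xv vneg ->
  (- 'E_Pr[fun w =>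
       RINCE lambda 1
         (score t (f (phi (xv w).1)) (f (phi (xv w).2)))
         (fun i => score t (f (phi (xv w).1)) (f (phi (vneg i w))))]
   <= (Lip f * (1 - lambda) * expR (1 / t) / t)%:E *
      wasserstein1
        (distribution P (map_both phi))
        (distribution (distribution P fst) phi \x
         distribution (distribution P snd) phi))%E.
Proof.
move=> K1 t0 /andP[l0 l1] lipf f1 lK [lawxv lawneg indep].
pose mu : probability _ R := distribution P (map_both phi).
pose nu : probability _ R := (distribution (distribution P fst) phi \x
  distribution (distribution P snd) phi)%E.
pose g (p : 'rV[R]_d * 'rV[R]_d) : R := expR (score t (f p.1) (f p.2)).
have g0 p : 0 <= g p by exact: expR_ge0.
have gM p : g p <= expR (1 / t) by exact: expR_score_le.
have mg : measurable_fun setT g by exact: measurable_expR_score.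
have mgE : measurable_fun setT (EFin \o g) by exact/measurable_EFinP.
(* The negative pair: the encoded anchor with the encoding of the [i]-th negative. *)
pose neg i := pair_mfun (phi \o (fst \o xv)) (phi \o vneg i).
have lawpos : same_law (distribution Pr (map_both phi \o xv)) mu.
  exact: same_law_comp.
have lawnegs i : same_law (distribution Pr (neg i)) nu.
  apply: same_law_pair.
  - by apply: same_law_comp; exact: same_law_comp.
  - by apply: same_law_comp; exact: lawneg.
  - move=> A B mA mB.
    (* An event about the anchor alone lies in the sigma-algebra of the whole pair [xv], through the
       preimage under [phi \o fst]. *)
    apply: (@mutually_independent2 _ _ _ _ _ _ None (Some i) _ _ indep) => //.
    + exists ((phi \o fst) @^-1` A); last by rewrite setTI.
      rewrite -[X in measurable X]setTI.
      by apply: measurableT_comp => //; exact: measurable_fst.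
    + exists (phi @^-1` B); last by rewrite setTI.
      exact: measurable_funPTI.
(* A bounded measurable function is integrable for a probability; this justifies linearity of the
   expectation below. *)
have g_int (h : {mfun Omega >-> ('rV[R]_d * 'rV[R]_d)%type}) :
    Pr.-integrable setT (EFin \o (g \o h)).
  apply: measurable_bounded_integrable => //.
  - by have := ltry (1 : R); rewrite -(probability_setT Pr).
  - by apply: measurableT_comp => //; exact: measurable_funPT.
  - exists (expR (1 / t)); split; first exact: num_real.
    by move=> M /ltW eM w _; rewrite /= ger0_norm//; exact: le_trans eM.
pose a : \bar R := (\int[Pr]_w (g (map_both phi (xv w)))%:E)%E.
have aE : (\int[mu]_p (g p)%:E = a)%E.
  by apply: (ge0_integral_law lawpos) => // p; rewrite lee_fin.
pose b : \bar R := (\int[nu]_p (g p)%:E)%E.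
have bE i : (\int[Pr]_w (g (neg i w))%:E = b)%E.
  by apply/esym/(ge0_integral_law (lawnegs i)) => // p; rewrite lee_fin.
have b_fin : b \is a fin_num.
  (* As [K >= 1], index 0 supplies a negative sample whose expectation is [b]. *)
  by rewrite -(bE (Ordinal K1)); exact: (integrable_fin_num _ (g_int _)).
have a_fin : a \is a fin_num.
  exact: (integrable_fin_num _ (g_int (map_both phi \o xv))).
have C_ge0 : 0 <= Lip f * expR (1 / t) / t.
  have [Lip_ge0 _] := lipschitz_bound_Lip lipf.
  by rewrite divr_ge0 ?mulr_ge0 ?expR_ge0// ltW.
have exp_eq : 'E_Pr[fun w => RINCE lambda 1
      (score t (f (phi (xv w).1)) (f (phi (xv w).2)))
      (fun i => score t (f (phi (xv w).1)) (f (phi (vneg i w))))]%E =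
    (lambda%:E * (K%:R%:E * b) - (1 - lambda)%:E * a)%E.
  rewrite unlock.
  under eq_integral do rewrite (RINCE1E _ _ _ _ (ltW l0)) EFinB !EFinM
    -sumEFin.
  have sum_int : Pr.-integrable setT (fun w => \sum_(i < K) (g (neg i w))%:E)%E.
    by apply: integrable_sum => // i _; exact: g_int.
  rewrite integralB//; last 2 first.
  - exact: integrableZl.
  - exact: (integrableZl _ _ (g_int (map_both phi \o xv))).
  rewrite (integralZl measurableT sum_int).
  rewrite (integralZl measurableT (g_int (map_both phi \o xv))).
  rewrite integral_sum//; last by move=> i; exact: (g_int (neg i)).
  congr (_ * _ - _)%E.
  rewrite (eq_bigr (fun=> b)); last by move=> i _; exact: bE.
  by rewrite sumr_const card_ord mule_natl.
have b_ge0 : (0 <= b)%E by apply: integral_ge0 => p _; rewrite lee_fin.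
apply: (@le_trans _ _ ((1 - lambda)%:E * (a - b))%E).
  rewrite exp_eq -(fineK a_fin) -(fineK b_fin) -!EFinM -EFinB -EFinN lee_fin.
  (* This product is exactly the gap between the two sides; its sign comes from
     [lambda * K > 1 - lambda]. *)
  have : 0 <= fine b * (lambda * K%:R - (1 - lambda)).
    by rewrite mulr_ge0 ?fine_ge0// subr_ge0 ltW.
  lra.
have -> : Lip f * (1 - lambda) * expR (1 / t) / t =
    (1 - lambda) * (Lip f * expR (1 / t) / t) by ring.
(* The nonnegative factor [1 - lambda] cancels, leaving the duality bound with the Lipschitz
   constant of [g]. *)
rewrite EFinM -muleA lee_wpmul2l ?lee_fin ?subr_ge0// -aE.
apply: (@integral_le_wasserstein1 _ _ mu nu g) => // p q.
exact: expR_score_lipschitz.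
Qed.
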